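(* For any $3$-generated numerical semigroup $H$ one has $$\operatorname{res}(H)\leq g(H)-n(H).$$
   Context: A numerical semigroup $H$ is a submonoid of $(\mathbb{N},+)$ (with $0\in\mathbb{N}$) such that $\mathbb{N}\setminus H$ is finite; it is $3$-generated if it is minimally generated by three elements. $M=H\setminus\{0\}$. The elements of $G(H)=\mathbb{N}\setminus H$ are the gaps of $H$, $g(H)=|G(H)|$, and the Frobenius number $F(H)$ is the largest integer not in $H$. $n(H)=|\{x\in H: x<F(H)\}|$. The set of pseudo-Frobenius numbers is $PF(H)=\{f\in G(H): f+M\subseteq H\}$. The canonical ideal of $H$ is $\Omega_H=\{-f+h : f\in PF(H),\ h\in H\}\subset\mathbb{Z}$, the anti-canonical ideal is $\Omega_H^{-1}=\{x\in\mathbb{Z}: x+\Omega_H\subseteq H\}$, the trace of $H$ is $\operatorname{tr}(H)=\Omega_H+\Omega_H^{-1}\subseteq H$, and the residue of $H$ is $\operatorname{res}(H)=|H\setminus\operatorname{tr}(H)|$. *)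

(* Defs.v *)
From HB Require Import structures.
From mathcomp Require Import all_boot all_order all_algebra.
From mathcomp Require Import finmap.
From mathcomp Require Import boolp classical_sets functions cardinality.
From mathcomp Require Import zify.

Set Implicit Arguments.
Unset Strict Implicit.
Unset Printing Implicit Defensive.

Import Order.TTheory GRing.Theory Num.Theory.

Local Open Scope classical_set_scope.
Local Open Scope card_scope.
Local Open Scope nat_scope.

Definition submonoid (H : set nat) : Prop :=
  H 0 /\ forall x y, H x -> H y -> H (x + y).

Definition gaps (H : set nat) : set nat := ~` H.

Definition numerical_semigroup (H : set nat) : Prop :=
  submonoid H /\ finite_set (gaps H).

Definition monoid_gen (A : set nat) : set nat := smallest submonoid A.

Definition minimally_generates (A H : set nat) : Prop :=
  monoid_gen A = H /\ forall B : set nat, B `<` A -> monoid_gen B <> H.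

Definition three_generated (H : set nat) : Prop :=
  exists2 A : set nat, A #= `I_3 & minimally_generates A H.

Definition inZ (H : set nat) : set int := [set h%:Z%R | h in H].

Definition genus (H : set nat) : nat := #|` fset_set (gaps H)|.

Definition is_frobenius (H : set nat) (F : int) : Prop :=
  ~ inZ H F /\ forall z : int, ~ inZ H z -> (z <= F)%R.

(* The default value -1 is never used: see [frobeniusP]. *)
Definition frobenius (H : set nat) : int := xget (-1)%R (is_frobenius H).

Definition sporadic (H : set nat) : set nat :=
  [set x | H x /\ (x%:Z < frobenius H)%R].

Definition n_sporadic (H : set nat) : nat := #|` fset_set (sporadic H)|.

Definition pseudo_frobenius (H : set nat) : set nat :=
  [set f | gaps H f /\ forall m, H m -> m <> 0 -> H (f + m)].

Definition canonical_ideal (H : set nat) : set int :=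
  [set (- f%:Z + h%:Z)%R | f in pseudo_frobenius H & h in H].

Definition anticanonical_ideal (H : set nat) : set int :=
  [set x | forall w, canonical_ideal H w -> inZ H (x + w)%R].

Definition trace_ideal (H : set nat) : set int :=
  [set (x + y)%R | x in canonical_ideal H & y in anticanonical_ideal H].

Definition residue_set (H : set nat) : set int := inZ H `\` trace_ideal H.

(* [fset_set] of an infinite set is empty; [finite_gaps], [finite_sporadic] and
   [finite_residue_set] show that only finite sets are counted here. *)
Definition residue (H : set nat) : nat := #|` fset_set (residue_set H)|.

Lemma inZ_nat (H : set nat) (n : nat) : inZ H n%:Z%R <-> H n.
Proof. by split=> [[m Hm [<-]]|Hn] //; exists n. Qed.

Lemma finite_gaps (H : set nat) : numerical_semigroup H -> finite_set (gaps H).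
Proof. by case. Qed.

Lemma frobeniusP (H : set nat) :
  numerical_semigroup H -> is_frobenius H (frobenius H).
Proof.
move=> [_ fG]; apply: (@xgetPex _ (-1)%R (is_frobenius H)).
pose s : seq nat := fset_set (gaps H).
have sP n : reflect (~ H n) (n \in s).
  by rewrite in_fset_set //; apply: (iffP idP); rewrite inE.
have [s0|[m ms]] : (forall n, n \notin s) \/ exists m, m \in s.
- by case: (s) => [|a l]; [left | right; exists a; rewrite inE eqxx].
- exists (-1)%R; split; first by case=> h _; lia.
  case=> [n|n] nH; last by lia.
  by case: nH; apply/inZ_nat; apply: contrapT => /sP; apply/negP.
- have ex : exists n, n \in s by exists m.
  have ub n : n \in s -> n <= \sum_(i <- s) i.
    by move=> ns; rewrite (big_rem n) //= leq_addr.
  case: (ex_maxnP ex ub) => F /sP HF maxF.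
  exists F%:Z%R; split; first by move/inZ_nat.
  case=> [n|n] nH; last by lia.
  suff : n <= F by lia.
  by apply/maxF/sP => Hn; apply/nH/inZ_nat.
Qed.

Lemma finite_sporadic (H : set nat) : finite_set (sporadic H).
Proof.
apply: (@sub_finite_set _ _ `I_(absz (frobenius H))); last exact: finite_II.
by move=> x [_] /=; lia.
Qed.

Lemma three_generated_gaps (H : set nat) : three_generated H -> gaps H !=set0.
Proof.
move=> [A cA [genA minA]]; apply: contrapT => noG.
have HT n : H n by apply: contrapT => Hn; apply: noG; exists n.
have A1 : A 1.
  apply: contrapT => nA1; have := HT 1; rewrite -genA => /(_ [set n | n <> 1]).
  apply=> //; split; first by split=> // x y /=; lia.
  by move=> x Ax x1; apply: nA1; rewrite -x1.
apply: (minA [set 1]).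
- split=> [x -> //|sA]; move: cA.
  have -> : A = [set 1] by apply/seteqP; split=> // x ->.
  by rewrite (card_eql card_set1) => /card_eq_II.
- apply/seteqP; split=> // n _ M [[M0 MD] /(_ 1 erefl) M1].
  by elim: n => // n Mn; rewrite -addn1; apply: MD.
Qed.

Lemma finite_residue_set (H : set nat) :
  numerical_semigroup H -> three_generated H -> finite_set (residue_set H).
Proof.
move=> nH /three_generated_gaps[g0 g0P].
have [FN Fmax] := frobeniusP nH.
have [[H0 HD] _] := nH.
have big n : (frobenius H < n%:Z)%R -> H n.
  move=> lt; apply: contrapT => Hn.
  have /Fmax : ~ inZ H n%:Z%R by move/inZ_nat.
  by rewrite leNgt lt.
case E : (frobenius H) FN big Fmax => [F|F] FN big Fmax; last first.
  by case: g0P; apply: big.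
have PF : pseudo_frobenius H F.
  split=> [HF|m Hm m0]; first by apply: FN; apply/inZ_nat.
  by apply: big; lia.
apply: (@sub_finite_set _ _ [set n%:Z%R | n in `I_(F + F + 1)]); last first.
  exact/finite_image/finite_II.
move=> _ [[n Hn <-] nT]; exists n => //=; rewrite ltnNge; apply/negP => le.
apply: nT; exists (- F%:Z + 0%:Z)%R; first by exists F => //; exists 0.
exists (n%:Z + F%:Z)%R; last by lia.
move=> _ [f [fG _] [h _ <-]].
have fF : f <= F.
  by have /Fmax : ~ inZ H f%:Z%R by move/inZ_nat.
exists (n + F - f + h); last by lia.
by apply: big; lia.
Qed.

(* Main.v *)
Require Import Defs.
From mathcomp Require Import all_boot all_order all_algebra.
From mathcomp Require Import finmap zify.
From mathcomp Require Import boolp classical_sets functions cardinality.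

(** The pseudo-Frobenius numbers of a semigroup [<a1,a2,a3>] inject, through
    [f + a1], into the outer corners of a staircase in [nat * nat]: the
    lexicographically least exponents [(b,c)] of the elements [b a2 + c a3] of
    the Apery set of [a1].  Every inner corner of that staircase has a value
    divisible by [a1]; two inner corners would differ by a relation between two
    distinct points of the staircase, so there are at most two outer corners,
    and [PF(H)] is contained in [{F, f'}] for some [f'].

    Put [d = F - f'].  If [h] and [h + d] lie in [H] then [h + F] lies in the
    anti-canonical ideal, so [h = (h + F) - F] lies in the trace.  Hence an
    element [h] of [H] outside the trace yields a gap [h + d] whose reflection
    [F - (h + d) = f' - h] is not in [H] either, whereas the sporadic elements
    [s] yield gaps [F - s] whose reflection [s] is in [H]. *)

Local Open Scope classical_set_scope.
Local Open Scope nat_scope.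

Definition comb3 (a1 a2 a3 : nat) : set nat :=
  [set n | exists x y z, n = x * a1 + y * a2 + z * a3].

(* [(b, c)] is the lexicographically least representation
   of an element of the Apery set of [a1]. *)
Definition stair (a1 a2 a3 b c : nat) : Prop :=
  forall x y z, b * a2 + c * a3 = x * a1 + y * a2 + z * a3 -> x = 0 /\ b <= y.

Definition outer_corner (a1 a2 a3 b c : nat) : Prop :=
  [/\ stair a1 a2 a3 b c, ~ stair a1 a2 a3 b.+1 c & ~ stair a1 a2 a3 b c.+1].

Lemma stair_down a1 a2 a3 b c b' c' : b' <= b -> c' <= c ->
  stair a1 a2 a3 b c -> stair a1 a2 a3 b' c'.
Proof.
move=> /subnKC <- /subnKC <- S x y z E.
have [|-> ?] := S x (y + (b - b')) (z + (c - c')); first by rewrite !mulnDl; lia.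
by split=> //; lia.
Qed.

(** A competing representation that uses [a2] or [a3] cancels one copy and is settled by the
    neighbour [(b, c.+1)] or [(b.+1, c)]; only a pure multiple of [a1] can break the condition. *)
Lemma stair_inner_corner a1 a2 a3 b c :
  stair a1 a2 a3 b c.+1 -> stair a1 a2 a3 b.+1 c -> ~ stair a1 a2 a3 b.+1 c.+1 ->
  exists x, b.+1 * a2 + c.+1 * a3 = x * a1.
Proof.
move=> Sl Sd nS; apply: contrapT => nx; apply: nS => x [|y] z E.
- case: z E => [|z] E; first by case: nx; exists x; lia.
  by have [] := Sd x 0 z; lia.
- by have [] := Sl x y z; lia.
Qed.

(** Descending column [b.+1] from height [c], the last point outside the staircase is an inner
    corner [(b.+1, q.+1)]. *)
Lemma stair_inner_corner_between a1 a2 a3 b c c' : c' <= c ->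
  stair a1 a2 a3 b c -> stair a1 a2 a3 b.+1 c' -> ~ stair a1 a2 a3 b.+1 c ->
  exists q x, [/\ c' <= q, q < c & b.+1 * a2 + q.+1 * a3 = x * a1].
Proof.
elim: c => [|c IH] le S S' nS.
  by case: nS; apply: stair_down S'.
have ltc : c' <= c.
  by rewrite -ltnS ltn_neqAle le andbT; apply/eqP => E; apply: nS; rewrite -E.
have [Sc|nSc] := pselect (stair a1 a2 a3 b.+1 c).
  have [x E] := stair_inner_corner _ _ _ _ _ S Sc nS.
  by exists c, x.
have [|q [x [? ? ?]]] := IH ltc _ S' nSc; first exact: stair_down S.
by exists q, x; split=> //; lia.
Qed.

Lemma outer_corner_anti a1 a2 a3 b c b' c' :
  outer_corner a1 a2 a3 b c -> outer_corner a1 a2 a3 b' c' -> b < b' -> c' < c.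
Proof.
move=> [_ nS _] [S' _ _] lt; rewrite ltnNge; apply/negP => le.
by apply: nS; apply: stair_down S'.
Qed.

Lemma outer_corner_inj a1 a2 a3 b c c' :
  outer_corner a1 a2 a3 b c -> outer_corner a1 a2 a3 b c' -> c = c'.
Proof.
move=> [S _ nS] [S' _ nS']; case: (ltngtP c c') => // lt.
- by case: nS; apply: stair_down S'.
- by case: nS'; apply: stair_down S.
Qed.

Lemma no_three_outer_corners a1 a2 a3 b1 c1 b2 c2 b3 c3 :
  outer_corner a1 a2 a3 b1 c1 -> outer_corner a1 a2 a3 b2 c2 ->
  outer_corner a1 a2 a3 b3 c3 -> b1 < b2 -> b2 < b3 -> False.
Proof.
move=> C1 C2 C3 lt12 lt23.
have ltc := outer_corner_anti _ _ _ _ _ _ _ C1 C2 lt12.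
have ltc' := outer_corner_anti _ _ _ _ _ _ _ C2 C3 lt23.
case: C1 C2 C3 => [S1 n1 _] [S2 n2 _] [S3 _ _].
have [|q [x [leq ltq E]]] := stair_inner_corner_between _ _ _ _ _ c2 (ltnW ltc) S1 _ n1.
  exact: stair_down S2.
have [|q' [x' [leq' ltq' E']]] := stair_inner_corner_between _ _ _ _ _ c3 (ltnW ltc') S2 _ n2.
  exact: stair_down S3.
(* The coordinate differences of the two inner corners stay below outer corners, so the stair
   condition applies to either side of [rel]. *)
have Sb : stair a1 a2 a3 (b2 - b1) 0 by apply: stair_down S2; lia.
have Sc : stair a1 a2 a3 0 (q - q') by apply: stair_down S1; lia.
have rel : (b2 - b1) * a2 + x * a1 = (q - q') * a3 + x' * a1 by nia.
case: (ltnP x x') => lex.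
- by have [] := Sb (x' - x) 0 (q - q'); nia.
- have [|x0 _] := Sc (x - x') (b2 - b1) 0; first by nia.
  (* Now [x = x'], so [(b2 - b1) a2 = (q - q') a3]; lexicographic minimality excludes this. *)
  by have [] := Sb 0 0 (q - q'); nia.
Qed.

(** Since [f] is a gap, no representation of [f + a1] uses [a1], and the least [b] gives a stair
    point. Since [f + a2] and [f + a3] lie in [H], both next points have a representation using
    [a1]. *)
Lemma pseudo_frobenius_outer_corner a1 a2 a3 f :
  a1 <> 0 -> a2 <> 0 -> a3 <> 0 -> pseudo_frobenius (comb3 a1 a2 a3) f ->
  exists b c, f + a1 = b * a2 + c * a3 /\ outer_corner a1 a2 a3 b c.
Proof.
move=> a1N a2N a3N [fN fP].
have ex : exists y, `[< exists z, f + a1 = y * a2 + z * a3 >].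
  have [||[|x] [y [z E]]] := fP a1; first by exists 1, 0, 0; lia.
  - exact: a1N.
  - by exists y; apply/asboolP; exists z.
  - by case: fN; exists x, y, z; lia.
case: (ex_minnP ex) => b /asboolP[c E] min_b.
exists b, c; split=> //; split.
- move=> [|x] y z; rewrite -E => E'.
    by split=> //; apply: min_b; apply/asboolP; exists z.
  by case: fN; exists x, y, z; lia.
- have [||x [y [z E']]] := fP a2; [by exists 0, 1, 0; lia|exact: a2N|].
  by move=> /(_ x.+1 y z) []; lia.
- have [||x [y [z E']]] := fP a3; [by exists 0, 0, 1; lia|exact: a3N|].
  by move=> /(_ x.+1 y z) []; lia.
Qed.

Lemma pseudo_frobenius_comb3 a1 a2 a3 f1 f2 f3 :
  a1 <> 0 -> a2 <> 0 -> a3 <> 0 ->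
  pseudo_frobenius (comb3 a1 a2 a3) f1 -> pseudo_frobenius (comb3 a1 a2 a3) f2 ->
  pseudo_frobenius (comb3 a1 a2 a3) f3 -> [\/ f1 = f2, f2 = f3 | f1 = f3].
Proof.
move=> a1N a2N a3N.
have inj f b c f' b' c' : f + a1 = b * a2 + c * a3 -> outer_corner a1 a2 a3 b c ->
    f' + a1 = b' * a2 + c' * a3 -> outer_corner a1 a2 a3 b' c' -> b = b' -> f = f'.
  move=> E C E' C' e; subst b'.
  by have e := outer_corner_inj _ _ _ _ _ _ C C'; subst c'; lia.
move=> /pseudo_frobenius_outer_corner -/(_ a1N a2N a3N) [b1 [c1 [E1 C1]]].
move=> /pseudo_frobenius_outer_corner -/(_ a1N a2N a3N) [b2 [c2 [E2 C2]]].
move=> /pseudo_frobenius_outer_corner -/(_ a1N a2N a3N) [b3 [c3 [E3 C3]]].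
have [/(inj _ _ _ _ _ _ E1 C1 E2 C2)|n12] := eqVneq b1 b2; first exact: Or31.
have [/(inj _ _ _ _ _ _ E2 C2 E3 C3)|n23] := eqVneq b2 b3; first exact: Or32.
have [/(inj _ _ _ _ _ _ E1 C1 E3 C3)|n13] := eqVneq b1 b3; first exact: Or33.
exfalso; move: n12 n23 n13; rewrite !neq_ltn.
by move=> /orP[?|?] /orP[?|?] /orP[?|?]; eauto using no_three_outer_corners.
Qed.

Lemma monoid_gen_comb3 a1 a2 a3 : monoid_gen [set a1; a2; a3] = comb3 a1 a2 a3.
Proof.
apply/seteqP; split=> n.
- apply; split; first split.
  + by exists 0, 0, 0.
  + move=> _ _ [x [y [z ->]]] [x' [y' [z' ->]]].
    by exists (x + x'), (y + y'), (z + z'); lia.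
  + by move=> _ [[->|->]|->]; [exists 1, 0, 0|exists 0, 1, 0|exists 0, 0, 1]; lia.
- move=> [x [y [z ->]]] M [[M0 MD] AM].
  have MM k a : M a -> M (k * a).
    by move=> Ma; elim: k => [//|k IH]; rewrite mulSn; apply: MD.
  by apply: (MD); [apply: (MD)|]; apply: MM; apply: AM; [left; left|left; right|right].
Qed.

(** A generator 0 could be dropped, as every submonoid contains 0. *)
Lemma minimally_generates_neq0 A H : minimally_generates A H -> ~ A 0.
Proof.
move=> [genA minA] A0; apply: (minA (A `\ 0)).
- by split=> [x []|/(_ 0 A0) [_ []]].
- rewrite -genA; apply/seteqP; split=> n nG M [subM AM]; apply: nG; split=> //.
  + by move=> x [Ax _]; exact: AM.
  + by move=> x Ax; have [->|x0] := pselect (x = 0); [case: subM|exact: AM].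
Qed.

Lemma three_generatedP H : three_generated H ->
  exists a1 a2 a3, [/\ a1 <> 0, a2 <> 0, a3 <> 0 & H = comb3 a1 a2 a3].
Proof.
move=> [A]; rewrite card_eq_sym => /card_set_bijP[f [fA _ fsurj]] minA.
have AN := minimally_generates_neq0 _ _ minA.
have EA : A = [set f 0; f 1; f 2].
  apply/seteqP; split=> [x /fsurj[[|[|[|n]]] //= _ <-]|x]; first by left; left.
  - by left; right.
  - by right.
  - by move=> [[->|->]|->]; apply: fA.
exists (f 0), (f 1), (f 2); split.
- by move=> E; apply: AN; rewrite -E; apply: fA.
- by move=> E; apply: AN; rewrite -E; apply: fA.
- by move=> E; apply: AN; rewrite -E; apply: fA.
- by rewrite -monoid_gen_comb3 -EA; case: minA.
Qed.

Lemma three_generated_pseudo_frobenius H F : three_generated H ->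
  pseudo_frobenius H F ->
  exists2 f', pseudo_frobenius H f' &
    forall f, pseudo_frobenius H f -> f = F \/ f = f'.
Proof.
move=> /three_generatedP[a1 [a2 [a3 [a1N a2N a3N ->]]]] PF.
have [[f' [Pf' nf']]|no] :=
  pselect (exists f', pseudo_frobenius (comb3 a1 a2 a3) f' /\ f' <> F).
- exists f' => // f Pf.
  have [] := pseudo_frobenius_comb3 _ _ _ _ _ _ a1N a2N a3N PF Pf' Pf.
  + by move=> E; case: nf'.
  + by right.
  + by left.
(* If [F] is the only pseudo-Frobenius number, [f' = F] and the shift [F - f'] is 0. *)
- exists F => // f Pf; left; apply: contrapT => nf; apply: no; by exists f.
Qed.

(** A gap excludes a negative Frobenius number, and everything above [F] lies in [H]. *)
Lemma frobenius_nat H : numerical_semigroup H -> gaps H !=set0 ->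
  exists F : nat, [/\ frobenius H = F%:Z%R, pseudo_frobenius H F &
    forall n, F < n -> H n].
Proof.
move=> nH [g gG]; have [FN Fmax] := frobeniusP nH.
have le n : ~ H n -> (n%:Z <= frobenius H)%R.
  by move=> Hn; apply: Fmax => /inZ_nat.
case E : (frobenius H) FN le => [F|F] FN le; last by have := le g gG; lia.
have big n : F < n -> H n.
  by move=> lt; apply: contrapT => /le; lia.
exists F; split=> //; split; first by move=> HF; apply/FN/inZ_nat.
by move=> m _ m0; apply: big; lia.
Qed.

Lemma trace_ideal_mem H F f' h : submonoid H -> pseudo_frobenius H F ->
  (forall f, pseudo_frobenius H f -> f = F \/ f = f') ->
  f' <= F -> H h -> H (h + (F - f')) -> trace_ideal H h%:Z%R.
Proof.
move=> [H0 HD] PF PFP le Hh Hhd.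
exists (- F%:Z + 0%:Z)%R; first by exists F => //; exists 0.
exists (h%:Z + F%:Z)%R; last by lia.
move=> _ [f /PFP[] -> [k Hk <-]].
- by exists (h + k); [exact: HD|lia].
- by exists (h + (F - f') + k); [exact: HD|lia].
Qed.

Theorem proposition2p2 (H : set nat)
  (numH : numerical_semigroup H) (genH : three_generated H) :
  ((residue H)%:Z <= (genus H)%:Z - (n_sporadic H)%:Z)%R.
Proof.
suff : residue H + n_sporadic H <= genus H by lia.
have [F [EF PF big]] := frobenius_nat _ numH (three_generated_gaps genH).
have [f' Pf' PFP] := three_generated_pseudo_frobenius _ _ genH PF.
have [subH finG] := numH; have HD := subH.2.
have gap_le n : ~ H n -> n <= F.
  by move=> Hn; rewrite leqNgt; apply/negP => /big.
have lef' : f' <= F by apply: gap_le; case: Pf'.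
have rP z : z \in fset_set (residue_set H) ->
    exists h, [/\ z = h%:Z%R, H h & ~ H (h + (F - f'))].
  rewrite in_fset_set; last exact: finite_residue_set.
  rewrite inE => -[[h Hh <-] hT]; exists h; split=> // Hhd.
  by apply: hT; apply: trace_ideal_mem PF PFP lef' Hh Hhd.
have sP s : s \in fset_set (sporadic H) -> H s /\ s < F.
  rewrite in_fset_set; last exact: finite_sporadic.
  by rewrite inE => -[Hs]; rewrite EF; split=> //; lia.
(* The map [h |-> h + d] on the residue set; [absz] only turns the integer [h] back into a natural
   number. *)
pose r_gap (z : int) : nat := absz z + (F - f').
rewrite /residue /n_sporadic /genus.
(* Both kinds of gaps are joined into one list; it suffices that this list is duplicate-free and
   consists of gaps. *)
rewrite -(size_map r_gap) -[X in _ + X](size_map (subn F)) -size_cat.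
apply: uniq_leq_size.
- rewrite cat_uniq; apply/and3P; split.
  + rewrite map_inj_in_uniq ?fset_uniq // => x y.
    by move=> /rP[h [-> _ _]] /rP[k [-> _ _]]; rewrite /r_gap; lia.
  (* A common value [h + (F - f') = F - s] would give [f' = s + h] in [H]. *)
  + apply/hasPn => _ /mapP[s /sP[Hs ltF] ->].
    apply/negP => /mapP[_ /rP[h [-> Hh Hhd]] E]; case: Pf' => f'N _.
    by apply: f'N; have -> : f' = s + h; [move: E; rewrite /r_gap; lia|exact: HD].
  + rewrite map_inj_in_uniq ?fset_uniq // => x y.
    by move=> /sP[_ ?] /sP[_ ?]; lia.
- move=> n; rewrite mem_cat in_fset_set // inE => /orP[/mapP[_ /rP[h [-> _ ?]] ->] //|].
  (* If [F - s] were in [H], adding [s] would put [F] in [H]. *)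
  move=> /mapP[s /sP[Hs lts] -> Hn]; case: PF => FN _; apply: FN.
  by rewrite -(subnK (ltnW lts)); apply: HD.
Qed.
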